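(* Complete Heyting algebra semantics is not strongly complete for intuitionistic second-order propositional logic $\mathbf{LJ2}$. That is, it is not the case that for every set $\Gamma$ of second-order propositional formulas and every second-order propositional formula $\varphi$, $\Gamma\vDash\varphi$ implies $\Gamma\vdash_2\varphi$.
   Context: Second-order propositional formulas ($\mathbf{LJ2}$-formulas) are built from propositional variables (countably infinitely many) and $\bot$ using $\wedge,\vee,\rightarrow$ and the quantifiers $\forall Y.\,\varphi$, $\exists Y.\,\varphi$ binding propositional variables; substitution $\varphi[T/Y]$ of a formula $T$ for a variable $Y$ is capture-avoiding. Calculus $\mathbf{LJ2}$. A sequent is $\Gamma\vdash_2 A$ with $A$ a formula and $\Gamma$ a finite sequence of formulas considered up to order; an empty right-hand side stands for $\bot$. Rules (premises $\Rightarrow$ conclusion): ax: $\varphi\vdash_2\varphi$; cut: $\Gamma\vdash_2\varphi$ and $\Lambda,\varphi\vdash_2\psi$ $\Rightarrow$ $\Gamma,\Lambda\vdash_2\psi$; left weakening: $\Gamma\vdash_2\psi$ $\Rightarrow$ $\Gamma,\varphi\vdash_2\psi$; left contraction: $\Gamma,\varphi,\varphi\vdash_2\psi$ $\Rightarrow$ $\Gamma,\varphi\vdash_2\psi$; right weakening: $\Gamma\vdash_2\bot$ $\Rightarrow$ $\Gamma\vdash_2\varphi$; $\vee L$: $\Gamma,\varphi\vdash_2\theta$ and $\Gamma,\psi\vdash_2\theta$ $\Rightarrow$ $\Gamma,\varphi\vee\psi\vdash_2\theta$; $\vee R$: $\Gamma\vdash_2\varphi$ $\Rightarrow$ $\Gamma\vdash_2\varphi\vee\psi$,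 and $\Gamma\vdash_2\psi$ $\Rightarrow$ $\Gamma\vdash_2\varphi\vee\psi$; $\wedge R$: $\Gamma\vdash_2\varphi$ and $\Gamma\vdash_2\psi$ $\Rightarrow$ $\Gamma\vdash_2\varphi\wedge\psi$; $\wedge L$: $\Gamma,\varphi\vdash_2\theta$ $\Rightarrow$ $\Gamma,\varphi\wedge\psi\vdash_2\theta$, and $\Gamma,\psi\vdash_2\theta$ $\Rightarrow$ $\Gamma,\varphi\wedge\psi\vdash_2\theta$; $\rightarrow L$: $\Gamma\vdash_2\varphi$ and $\Lambda,\psi\vdash_2\theta$ $\Rightarrow$ $\Gamma,\Lambda,\varphi\rightarrow\psi\vdash_2\theta$; $\rightarrow R$: $\Gamma,\varphi\vdash_2\psi$ $\Rightarrow$ $\Gamma\vdash_2\varphi\rightarrow\psi$; $\bot L$: $\bot\vdash_2\varphi$; $\forall L$: $\Gamma,\varphi[T/Y]\vdash_2\psi$ $\Rightarrow$ $\Gamma,\forall Y.\varphi\vdash_2\psi$; $\forall R$: $\Gamma\vdash_2\varphi$ $\Rightarrow$ $\Gamma\vdash_2\forall Y.\varphi$, if $Y$ is not free in $\Gamma$; $\exists R$: $\Gamma\vdash_2\varphi[T/Y]$ $\Rightarrow$ $\Gamma\vdash_2\exists Y.\varphi$; $\exists L$: $\Gamma,\varphi\vdash_2\psi$ $\Rightarrow$ $\Gamma,\exists Y.\varphi\vdash_2\psi$, if $Y$ is not free in $\Gamma$ or $\psi$. For a (possibly infinite) set $\Gamma$ of formulas, $\Gamma\vdash_2\varphi$ (syntactic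 consequence) means that there is a finite sequence $\Lambda$ of elements of $\Gamma$ such that $\Lambda\vdash_2\varphi$ is derivable in $\mathbf{LJ2}$. Semantics. A complete Heyting algebra (cHA) is a Heyting algebra $(H,\sqsubseteq)$ in which every subset has a least upper bound and a greatest lower bound. A valuation $v$ maps propositional variables to elements of $H$. The interpretation is: $\langle X\rangle^H_v=v(X)$, $\langle\bot\rangle^H_v=\bot_H$, $\wedge,\vee,\rightarrow$ are interpreted by $\sqcap,\sqcup,\Rightarrow$, $\langle\forall Y.\varphi\rangle^H_v=\inf_{y\in H}\langle\varphi\rangle^H_{v(Y\mapsto y)}$ and $\langle\exists Y.\varphi\rangle^H_v=\bigsqcup_{y\in H}\langle\varphi\rangle^H_{v(Y\mapsto y)}$, where $v(Y\mapsto y)$ agrees with $v$ except that it sends $Y$ to $y$. A cHA model is $\mathcal H=(H,\sqsubseteq,v)$ with $(H,\sqsubseteq)$ a cHA and $v$ a valuation; $\mathcal H\models\varphi$ means $\langle\varphi\rangle^H_v=\top_H$. $\Gamma\vDash\varphi$ (semantic consequence) means: every cHA model $\mathcal H$ with $\mathcal H\models\psi$ for all $\psi\in\Gamma$ also satisfies $\mathcal H\models\varphi$. *)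

(* Defs.v *)
From HB Require Import structures.
From mathcomp Require Import all_boot all_order.
From mathcomp Require Import boolp classical_sets.

Set Implicit Arguments.
Unset Strict Implicit.
Unset Printing Implicit Defensive.

Import Order.TTheory.
Local Open Scope classical_set_scope.
Local Open Scope order_scope.

Inductive form : Type :=
  | Var of nat
  | Bot
  | And of form & form
  | Or of form & form
  | Imp of form & form
  | All of nat & form
  | Ex of nat & form.

Definition form_eq_dec (A B : form) : {A = B} + {A <> B}.
Proof. by decide equality; apply: eq_comparable. Defined.

HB.instance Definition _ := hasDecEq.Build form (compareP form_eq_dec).

Fixpoint fv (A : form) : seq nat :=
  match A with
  | Var x => [:: x]
  | Bot => [::]
  | And B C | Or B C | Imp B C => fv B ++ fv C
  | All y B | Ex y B => [seq x <- fv B | x != y]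
  end.

(* [y] itself if it does not occur in [xs], otherwise a variable that does
   not occur in [xs] *)
Definition avoid (y : nat) (xs : seq nat) : nat :=
  if y \in xs then (\max_(x <- xs) x).+1 else y.

(* Simultaneous capture-avoiding substitution.  A bound variable is renamed
   only if it would capture a variable of a substituted formula; performing
   the renaming together with the substitution keeps the recursion
   structural. *)
Fixpoint msubst (s : nat -> form) (A : form) : form :=
  let binder y B :=
    avoid y (flatten [seq fv (s x) | x <- fv B & x != y]) in
  match A with
  | Var x => s x
  | Bot => Bot
  | And B C => And (msubst s B) (msubst s C)
  | Or B C => Or (msubst s B) (msubst s C)
  | Imp B C => Imp (msubst s B) (msubst s C)
  | All y B => let z := binder y B in
               All z (msubst [eta s with y |-> Var z] B)
  | Ex y B => let z := binder y B in
              Ex z (msubst [eta s with y |-> Var z] B)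
  end.

(* [subst A T y] is A[T/y]. *)
Definition subst (A T : form) (y : nat) : form :=
  msubst [eta Var with y |-> T] A.

(* Contexts are sequences up to order, hence the rule [lj_perm].  An empty
   right-hand side is represented by [Bot]. *)
Inductive LJ2 : seq form -> form -> Prop :=
  | lj_perm G D A : perm_eq G D -> LJ2 G A -> LJ2 D A
  | lj_ax A : LJ2 [:: A] A
  | lj_cut G D A B : LJ2 G A -> LJ2 (A :: D) B -> LJ2 (G ++ D) B
  | lj_weakL G A B : LJ2 G B -> LJ2 (A :: G) B
  | lj_contrL G A B : LJ2 [:: A, A & G] B -> LJ2 (A :: G) B
  | lj_weakR G A : LJ2 G Bot -> LJ2 G A
  | lj_orL G A B C : LJ2 (A :: G) C -> LJ2 (B :: G) C -> LJ2 (Or A B :: G) C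
  | lj_orR1 G A B : LJ2 G A -> LJ2 G (Or A B)
  | lj_orR2 G A B : LJ2 G B -> LJ2 G (Or A B)
  | lj_andR G A B : LJ2 G A -> LJ2 G B -> LJ2 G (And A B)
  | lj_andL1 G A B C : LJ2 (A :: G) C -> LJ2 (And A B :: G) C
  | lj_andL2 G A B C : LJ2 (B :: G) C -> LJ2 (And A B :: G) C
  | lj_impL G D A B C :
      LJ2 G A -> LJ2 (B :: D) C -> LJ2 (Imp A B :: G ++ D) C
  | lj_impR G A B : LJ2 (A :: G) B -> LJ2 G (Imp A B)
  | lj_botL A : LJ2 [:: Bot] A
  | lj_allL G A T y B : LJ2 (subst A T y :: G) B -> LJ2 (All y A :: G) B
  | lj_allR G A y :
      (forall C, C \in G -> y \notin fv C) -> LJ2 G A -> LJ2 G (All y A)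
  | lj_exR G A T y : LJ2 G (subst A T y) -> LJ2 G (Ex y A)
  | lj_exL G A y B :
      (forall C, C \in G -> y \notin fv C) -> y \notin fv B ->
      LJ2 (A :: G) B -> LJ2 (Ex y A :: G) B.

Definition syn_consequence (G : set form) (A : form) : Prop :=
  exists L : seq form, [set` L] `<=` G /\ LJ2 L A.

HB.mixin Record hasHeytingImp d T of Order.TBLattice d T := {
  himp : T -> T -> T;
  himpP : forall x y z : T, (z <= himp x y) = (z `&` x <= y)
}.

#[short(type="heytingType")]
HB.structure Definition Heyting d :=
  { T of hasHeytingImp d T & Order.TBLattice d T }.

HB.mixin Record hasSupInf d T of Order.POrder d T := {
  supremums_ex : forall A : set T, supremums A !=set0;
  infimums_ex : forall A : set T, infimums A !=set0
}.

#[short(type="completeHeytingType")]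
HB.structure Definition CompleteHeyting d :=
  { T of Heyting d T & hasSupInf d T }.

(* The default values given to [infimum] and [supremum] are irrelevant, since
   the ranges are nonempty. *)
Fixpoint interp d (H : completeHeytingType d) (v : nat -> H) (A : form) : H :=
  match A with
  | Var x => v x
  | Bot => \bot
  | And B C => interp v B `&` interp v C
  | Or B C => interp v B `|` interp v C
  | Imp B C => himp (interp v B) (interp v C)
  | All y B => infimum \top (range (fun a => interp [eta v with y |-> a] B))
  | Ex y B => supremum \bot (range (fun a => interp [eta v with y |-> a] B))
  end.

Definition satisfies d (H : completeHeytingType d) (v : nat -> H) (A : form) :
  Prop := interp v A = \top.

Definition sem_consequence (G : set form) (A : form) : Prop :=
  forall (d : Order.disp_t) (H : completeHeytingType d) (v : nat -> H),
    (forall B, G B -> satisfies v B) -> satisfies v A.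

(* Main.v *)
(**
  A family [x_0, x_1, ...] in a complete Heyting algebra with
  [x_n -> x_{n+1} <= x_n] for all [n] has an infimum [l] that is a limit from
  above: [inf_y (y \/ (y -> l)) <= x_n \/ (x_n -> l) <= x_n] for all [n].  Hence
  the formula saying that there is a [Y] below [x_0] with
  [(forall Z. Z \/ (Z -> Y)) -> Y] is a semantic consequence of this infinite
  set of hypotheses.  In a chain, the value of [forall Z. Z \/ (Z -> Y)] at
  [Y = y < top] is the infimum of the elements above [y], so in a finite chain
  the formula is false as soon as [x_0 < top]; but a finite chain can satisfy
  any finite set of the hypotheses.  As [LJ2] is sound, its finitary consequence
  relation therefore misses this semantic consequence.
*)

Require Import Defs.
From HB Require Import structures.
From mathcomp Require Import all_boot all_order.
From mathcomp Require Import boolp classical_sets.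

Set Implicit Arguments.
Unset Strict Implicit.
Unset Printing Implicit Defensive.

Import Order.TTheory.
Local Open Scope classical_set_scope.
Local Open Scope order_scope.

(** * Substitution lemma and soundness of [LJ2] *)

Lemma avoid_notin y xs : avoid y xs \notin xs.
Proof.
rewrite /avoid; case: ifPn => // _.
apply/negP => xs_max; have := @leq_bigmax_seq _ _ xpredT id _ xs_max isT.
by rewrite ltnn.
Qed.

Section Soundness.
Variables (d : Order.disp_t) (H : completeHeytingType d).
Implicit Types (v w : nat -> H) (s : nat -> form) (F : H -> H).

Lemma infimums_infimum (A : set H) : A !=set0 -> infimums A (infimum \top A).
Proof.
move=> A0; rewrite /infimum ifF; last by apply/negbTE/set0P.
(* [infimum] chooses by [xget], whose fallback case would contradict completeness. *)
by case: xgetP => // /(_ _) no; have [x Ax] := infimums_ex A; case: (no x).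
Qed.

Lemma supremums_supremum (A : set H) :
  A !=set0 -> supremums A (supremum \bot A).
Proof.
move=> A0; rewrite /supremum ifF; last by apply/negbTE/set0P.
by case: xgetP => // /(_ _) no; have [x Ax] := supremums_ex A; case: (no x).
Qed.

Lemma range_neq0 F : range F !=set0.
Proof. by exists (F \top), \top. Qed.

Lemma infimum_range_le F a : infimum \top (range F) <= F a.
Proof. by have [+ _] := infimums_infimum (range_neq0 F); apply; exists a. Qed.

Lemma le_infimum_range F x :
  (forall a, x <= F a) -> x <= infimum \top (range F).
Proof.
by move=> xF; have [_] := infimums_infimum (range_neq0 F); apply=> _ [a _ <-].
Qed.

Lemma le_supremum_range F a : F a <= supremum \bot (range F).
Proof. by have [+ _] := supremums_supremum (range_neq0 F); apply; exists a. Qed.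

Lemma supremum_range_le F x :
  (forall a, F a <= x) -> supremum \bot (range F) <= x.
Proof.
by move=> Fx; have [_] := supremums_supremum (range_neq0 F); apply=> _ [a _ <-].
Qed.

Lemma interp_fv v w A : {in fv A, v =1 w} -> interp v A = interp w A.
Proof.
have bind y B u u' a : {in [seq x <- fv B | x != y], u =1 u'} ->
    {in fv B, [eta u with y |-> a] =1 [eta u' with y |-> a : H]}.
  move=> uu' x xB /=; case: eqVneq => //= xy.
  by apply: uu'; rewrite mem_filter xy.
elim: A v w => [x|//|B IB C IC|B IB C IC|B IB C IC|y B IB|y B IB] v w /= vw.
- by apply: vw; rewrite mem_head.
- by congr (_ `&` _); [apply: IB | apply: IC] => x xA;
    apply: vw; rewrite mem_cat xA ?orbT.
- by congr (_ `|` _); [apply: IB | apply: IC] => x xA;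
    apply: vw; rewrite mem_cat xA ?orbT.
- by congr himp; [apply: IB | apply: IC] => x xA;
    apply: vw; rewrite mem_cat xA ?orbT.
- by congr infimum; apply: eq_imagel => a _; apply: IB; apply: bind.
- by congr supremum; apply: eq_imagel => a _; apply: IB; apply: bind.
Qed.

Lemma interp_update v y a A :
  y \notin fv A -> interp [eta v with y |-> a] A = interp v A.
Proof.
move=> yA; apply: interp_fv => x xA /=; case: eqP => // xy.
by rewrite -xy xA in yA.
Qed.

(** Updating [v] at the renamed binder does not affect the formulas substituted under it, since
    [avoid] picks a name not free in them. Both [v] and [s] stay general in the induction, as a
    binder changes both. *)
Lemma interp_msubst v s A :
  interp v (msubst s A) = interp (fun x => interp v (s x)) A.
Proof.
pose binder s y B := avoid y (flatten [seq fv (s x) | x <- fv B & x != y]).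
have bind (t : nat -> form) y B (u : nat -> H) (a : H) : (forall v s,
      interp v (msubst s B) = interp (fun x => interp v (s x)) B) ->
    interp [eta u with binder t y B |-> a]
      (msubst [eta t with y |-> Var (binder t y B)] B) =
    interp [eta (fun x => interp u (t x)) with y |-> a] B.
  move=> IB; rewrite IB; apply: interp_fv => x xB /=.
  case: (eqVneq x y) => [_|xy] /=; first by rewrite eqxx.
  apply: interp_update; move: (avoid_notin y _ : binder t y B \notin _).
  apply: contra => zx; apply/flatten_mapP.
  by exists x; rewrite // mem_filter xy.
elim: A v s => [x|//|B IB C IC|B IB C IC|B IB C IC|y B IB|y B IB] v s /=.
- by [].
- by rewrite IB IC.
- by rewrite IB IC.
- by rewrite IB IC.
- by congr infimum; apply: eq_imagel => a _; apply: bind.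
- by congr supremum; apply: eq_imagel => a _; apply: bind.
Qed.

Lemma interp_subst v A T y :
  interp v (subst A T y) = interp [eta v with y |-> interp v T] A.
Proof.
by rewrite interp_msubst; apply: interp_fv => x _ /=; case: eqP.
Qed.

Lemma himp_meet (x y : H) : himp x y `&` x <= y.
Proof. by rewrite -himpP. Qed.

Lemma himp_top (x y : H) : (himp x y == \top) = (x <= y).
Proof. by rewrite -le1x himpP meet1x. Qed.

(** Meeting with [g] has the right adjoint [himp g], hence preserves suprema; [lj_exL] needs this
    with the context as [g]. *)
Lemma le_meet_supremum_range F (g c : H) :
  (forall a, F a `&` g <= c) -> supremum \bot (range F) `&` g <= c.
Proof.
by move=> Fg; rewrite -himpP; apply: supremum_range_le => a; rewrite himpP.
Qed.

Definition interp_ctx v (G : seq form) : H := \meet_(B <- G) interp v B.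

Lemma interp_ctx_update v y a (G : seq form) :
  (forall C, C \in G -> y \notin fv C) ->
  interp_ctx [eta v with y |-> a] G = interp_ctx v G.
Proof. by move=> yG; apply: eq_big_seq => C /yG; apply: interp_update. Qed.

(** The induction keeps [v] general: [lj_allR] and [lj_exL] use their hypothesis at updates of [v]
    at the bound variable, which leave the value of the context unchanged by the side condition. *)
Lemma LJ2_sound v (G : seq form) A : LJ2 G A -> interp_ctx v G <= interp v A.
Proof.
rewrite /interp_ctx => GA; elim: GA v => {G A} /=.
- by move=> G D A GD _ IA v; rewrite -(perm_big _ GD).
- by move=> A v; rewrite big_seq1.
- move=> G D A B _ IA _ IB v; rewrite big_cat /=.
  by apply: le_trans (IB v); rewrite big_cons leI2.
- by move=> G A B _ IB v; rewrite big_cons leIxr.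
- by move=> G A B _ IB v; have := IB v; rewrite !big_cons meetA meetxx.
- by move=> G A _ IB v; apply: le_trans (IB v) _; rewrite le0x.
(* Residuation moves the context to the right, so the universal property of the join suffices. *)
- move=> G A B C _ IA _ IB v; have := IA v; have := IB v.
  by rewrite !big_cons /= -!himpP leUx => -> ->.
- by move=> G A B _ IA v; rewrite lexUl.
- by move=> G A B _ IB v; rewrite lexUr.
- by move=> G A B _ IA _ IB v; rewrite lexI IA IB.
- move=> G A B C _ IA v; apply: le_trans (IA v).
  by rewrite !big_cons leI2 //= leIl.
- move=> G A B C _ IB v; apply: le_trans (IB v).
  by rewrite !big_cons leI2 //= leIr.
- move=> G D A B C _ IA _ IB v; apply: le_trans (IB v).
  rewrite !big_cons big_cat /= meetA leI2 //.
  by apply: le_trans (himp_meet (interp v A) _); rewrite leI2.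
- by move=> G A B _ IB v; rewrite himpP meetC; have := IB v; rewrite big_cons.
- by move=> A v; rewrite big_seq1 le0x.
- move=> G A T y B _ IB v; apply: le_trans (IB v).
  by rewrite !big_cons leI2 // interp_subst infimum_range_le.
- move=> G A y yG _ IA v; apply: le_infimum_range => a.
  by rewrite -/(interp_ctx v G) -(interp_ctx_update v a yG); apply: IA.
- move=> G A T y _ IA v; apply: le_trans (IA v) _.
  by rewrite interp_subst
    (le_supremum_range (fun a => interp [eta v with y |-> a] A)).
- move=> G A y B yG yB _ IB v; rewrite big_cons.
  apply: le_meet_supremum_range => a; have := IB [eta v with y |-> a].
  rewrite big_cons (interp_update v a yB).
  by rewrite -/(interp_ctx _ G) interp_ctx_update.
Qed.

End Soundness.

(** * Finite chains as complete Heyting algebras *)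

Section FiniteChain.
Variables (d : Order.disp_t) (T : finTBOrderType d).
Implicit Types (x y z : T) (A : set T).

(** Gödel implication, the residual of the minimum in a linear order. *)
Definition chain_imp x y : T := if x <= y then \top else y.

Lemma chain_impP x y z : (z <= chain_imp x y) = (z `&` x <= y).
Proof.
rewrite /chain_imp leIx; case: ifP => [_|]; first by rewrite lex1 orbT.
by rewrite orbF.
Qed.

Lemma fin_supremums_ex A : supremums A !=set0.
Proof.
exists (\join_(x | `[< A x >]) x); split => [x Ax|x xA].
  by rewrite joins_sup //; apply/asboolP.
by apply/joinsP => y /asboolP; apply: xA.
Qed.

Lemma fin_infimums_ex A : infimums A !=set0.
Proof.
exists (\meet_(x | `[< A x >]) x); split => [x Ax|x xA].
  by rewrite meets_inf //; apply/asboolP.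
by apply/meetsP => y /asboolP; apply: xA.
Qed.

End FiniteChain.

Definition chain (n : nat) : predArgType := 'I_n.+1.

HB.instance Definition _ n := Order.FinTotal.copy (chain n) 'I_n.+1.

Fact chain_le0x n (x : chain n) : (ord0 : chain n) <= x.
Proof. exact: leq0n. Qed.

Fact chain_lex1 n (x : chain n) : x <= (ord_max : chain n).
Proof. exact: leq_ord. Qed.

HB.instance Definition _ n :=
  Order.hasBottom.Build _ (chain n) (@chain_le0x n).
HB.instance Definition _ n := Order.hasTop.Build _ (chain n) (@chain_lex1 n).
HB.instance Definition _ n :=
  hasHeytingImp.Build _ (chain n) (@chain_impP _ (chain n)).
HB.instance Definition _ n :=
  hasSupInf.Build _ (chain n)
    (@fin_supremums_ex _ (chain n)) (@fin_infimums_ex _ (chain n)).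

Lemma chain_himp_gt n (x y : chain n) : y < x -> himp x y = y.
Proof. by move=> yx; rewrite /himp /= /chain_imp leNgt yx. Qed.

(** * The infinitary consequence and its failure in finite chains *)

(* [Var 0] and [Var 1] are kept for the bound variables of [limit_below]. *)
Definition seq_var (n : nat) : form := Var n.+2.

Definition descent (n : nat) : form :=
  Imp (Imp (seq_var n) (seq_var n.+1)) (seq_var n).

Definition limit_below : form :=
  Ex 0 (And (Imp (Var 0) (seq_var 0))
            (Imp (All 1 (Or (Var 1) (Imp (Var 1) (Var 0)))) (Var 0))).

Lemma descent_limit_below : sem_consequence (range descent) limit_below.
Proof.
move=> d H v vdesc; apply/le_anti; rewrite lex1 /=.
have desc n : himp (v n.+2) (v n.+3) <= v n.+2.
  by rewrite -himp_top; apply/eqP/(vdesc (descent n)); exists n.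
have [l [lb glb]] := infimums_ex (range (fun n => v n.+2)).
apply: le_trans (le_supremum_range _ l) => /=; rewrite lexI !le1x !himp_top.
apply/andP; split; first by apply: lb; exists 0%N.
apply: glb => _ [n _ <-]; apply: le_trans (infimum_range_le _ (v n.+2)) _ => /=.
(* Since [l] is below [x_{n+1}], [x_n -> l] is below [x_n -> x_{n+1}], which descent puts below
   [x_n]. *)
rewrite leUx lexx /=; apply: le_trans (desc n).
rewrite himpP; apply: le_trans (himp_meet _ _) _.
by apply: lb; exists n.+1.
Qed.

(** Each candidate [y] contributes at most [v 2]: if [y] is above [v 2], the first conjunct
    collapses to [v 2]; otherwise the second collapses to [y]. *)
Lemma limit_below_chain n (v : nat -> chain n) :
  v 2 < \top -> ~ satisfies v limit_below.
Proof.
move=> v2; apply/eqP; rewrite lt_eqF // (le_lt_trans _ v2) //.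
apply: supremum_range_le => y /=.
case: (leP y (v 2)) => [yv|vy]; last by rewrite chain_himp_gt // leIl.
have yn : (y < n)%N := le_lt_trans yv v2.
(* As [y] is not the top, it has an immediate successor, which bounds every [z \/ (z -> y)] from
   below. *)
pose y' : chain n := inord y.+1.
have yy' : y < y' by rewrite ltEord inordK.
rewrite [X in _ `&` X]chain_himp_gt ?leIxr //.
apply: lt_le_trans yy' _; apply: le_infimum_range => z /=.
case: (leP z y) => [zy|yz].
  have /eqP -> : himp z y == \top by rewrite himp_top.
  by rewrite joinx1 lex1.
by rewrite lexUl // leEord inordK.
Qed.

(** As long as the values decrease strictly, [x_m -> x_{m+1}] is just [x_{m+1}]. From index [n] on,
    truncated subtraction repeats [0], whence the bound on [m]. *)
Lemma descent_chain n (m : nat) : (m < n)%N ->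
  satisfies (fun k => inord (n - k.-2) : chain n.+1) (descent m).
Proof.
move=> mn; apply/eqP; rewrite /= himp_top.
have lt_inord : (inord (n - m.+1) : chain n.+1) < inord (n - m).
  by rewrite ltEord !inordK ?ltnS ?leq_subr ?ltn_sub2l // ltnW // ltnS leq_subr.
by rewrite chain_himp_gt ?ltW.
Qed.

(** Finiteness of derivations enters here: one bound on the indices determines how long a chain is
    needed. *)
Lemma seq_descent_bounded (L : seq form) : [set` L] `<=` range descent ->
  exists n, forall B, B \in L -> exists2 m, (m < n)%N & descent m = B.
Proof.
elim: L => [|A L IL] Ldesc; first by exists 0%N.
have [|n nL] := IL.
  by move=> B BL; apply: Ldesc; apply: mem_behead.
have [m _ mA] : range descent A by apply: Ldesc; rewrite /= mem_head.
exists (maxn m.+1 n) => B; rewrite inE => /predU1P[->|/nL[k kn kB]].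
  by exists m; rewrite // leq_maxl.
by exists k; rewrite // leq_max kn orbT.
Qed.

Theorem theorem5p14 :
  ~ (forall (G : set form) (A : form),
       sem_consequence G A -> syn_consequence G A).
Proof.
move=> /(_ _ _ descent_limit_below) [L [/seq_descent_bounded [n Ln] LJ_L]].
(* The top of [chain n.+1] is [n.+1], one above the value [n] of the first sequence variable. *)
pose v k : chain n.+1 := inord (n - k.-2).
have v2 : v 2 < \top by rewrite ltEord inordK //= subn0.
apply: (limit_below_chain v2); apply: le_anti; rewrite lex1 /=.
apply: le_trans (LJ2_sound v LJ_L); rewrite /interp_ctx big_seq.
apply/meetsP_seq => B BL _.
by have [m /descent_chain + <-] := Ln _ BL; move=> ->.
Qed.
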